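(* The 9-element set $\{0,1,2,3,4,5,7,9,10\}$ is extreme in $\mathbb Z_{13}$.
   Context: $\mathbb Z_n$ denotes the cyclic group of order $n$. For a finite abelian group $G$ with dual group $\Gamma$ and a complex measure $\mu$ on $G$: $\|\mu\|=\sum_{x\in G}|\mu(\{x\})|$, $\widehat\mu(\gamma)=\sum_{x\in G}\overline{\gamma(x)}\,\mu(\{x\})$ for $\gamma\in\Gamma$, and $\|\widehat\mu\|_\infty=\max_\gamma|\widehat\mu(\gamma)|$. A non-zero measure $\mu$ on $G$ is extreme if $\|\widehat\mu\|_\infty=\|\mu\|/\sqrt{\#\mathrm{supp}\,\mu}$. A set $E\subset G$ is extreme if it is the support of an extreme measure on $G$. *)

(* Defs.v *)
From HB Require Import structures.
From mathcomp Require Import all_boot all_order all_algebra.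

Set Implicit Arguments.
Unset Strict Implicit.
Unset Printing Implicit Defensive.

Import Order.TTheory GRing.Theory Num.Theory.

Local Open Scope ring_scope.

(* A complex measure on a finite group is given by its point masses: [mu x]
   stands for mu({x}).  Norms and square roots of nonnegative reals are taken
   in the field C itself; they are its nonnegative real elements. *)

Section ExtremeMeasures.

Variables (C : numClosedFieldType) (G : finZmodType).
Implicit Types (mu : {ffun G -> C}) (gamma : G -> C) (E : {set G}).

Definition measure_norm mu : C := \sum_(x : G) `|mu x|.

Definition supp mu : {set G} := [set x | mu x != 0].

(* Homomorphisms from G to the unit circle. *)
Definition in_dual gamma : Prop :=
  (forall x, `|gamma x| = 1) /\ {morph gamma : x y / x + y >-> x * y}.

Definition fourier mu gamma : C := \sum_(x : G) (gamma x)^* * mu x.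

(* M is the maximum of |fourier mu gamma| over the dual group. *)
Definition is_fourier_sup_norm mu (M : C) : Prop :=
  (exists2 gamma, in_dual gamma & `|fourier mu gamma| = M) /\
  (forall gamma, in_dual gamma -> `|fourier mu gamma| <= M).

Definition extreme_measure mu : Prop :=
  mu <> 0 /\ is_fourier_sup_norm mu (measure_norm mu / sqrtC #|supp mu|%:R).

Definition extreme_set E : Prop :=
  exists2 mu, extreme_measure mu & supp mu = E.

End ExtremeMeasures.

(* Main.v *)
Require Import Defs.
From HB Require Import structures.
From mathcomp Require Import all_boot all_order all_algebra.
From mathcomp Require Import reals complex.
From mathcomp Require Import ring.
Import Order.TTheory GRing.Theory Num.Theory.
Local Open Scope ring_scope.

(** Comparing the maximum of the Fourier transform with its quadratic mean
    (Parseval) and the total mass with its quadratic mean on the support [E]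
    (Cauchy-Schwarz), one sees that [mu] is extreme exactly when both [mu] on [E]
    and its Fourier transform have constant modulus.  Up to scaling, this means
    that [mu] is unimodular on [E] and that its periodic autocorrelation, the
    inverse transform of the squared modulus, vanishes away from [0].
    Such a measure exists here with values [1] and [-1].  The complement
    {6, 8, 11, 12} of the given set is a perfect difference set in Z_13 (its 12
    nonzero differences are distinct), that is, a line of the cyclic projective
    plane of order 3, and with suitable signs on the remaining 9 points one
    obtains a circulant weighing matrix CW(13, 9).  The lemma
    [unimodular_uncorrelated_extreme] turns such a sign pattern into an extreme
    measure; that the pattern [signs] is uncorrelated with its translates is a
    finite computation with integers. *)

Section Autocorrelation.

Variables (C : numClosedFieldType) (G : finZmodType).
Implicit Types (mu : {ffun G -> C}) (gamma : G -> C) (E : {set G}).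

Lemma in_dual0 gamma : in_dual gamma -> gamma 0 = 1.
Proof.
case=> gamma_norm gammaD; have gamma0_neq0 : gamma 0 != 0.
  by rewrite -normr_eq0 gamma_norm oner_eq0.
by apply: (mulfI gamma0_neq0); rewrite -gammaD addr0 mulr1.
Qed.

Lemma in_dual1 : in_dual (fun _ : G => 1 : C).
Proof. by split=> [x | x y]; rewrite ?normr1 ?mulr1. Qed.

Definition autocorrelation mu (d : G) : C := \sum_x mu (x + d)%R * (mu x)^*.

(** The Wiener-Khinchin identity: in the double sum for [|fourier mu gamma|^2],
    the character only sees the difference of the two summation variables. *)
Lemma normsq_fourier mu gamma : in_dual gamma ->
  `|fourier mu gamma| ^+ 2 = \sum_d (gamma d)^* * autocorrelation mu d.
Proof.
move=> [gamma_norm gammaD]; rewrite normCK /fourier rmorph_sum mulr_sumr.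
under [RHS]eq_bigr do rewrite mulr_sumr.
rewrite [RHS]exchange_big; apply: eq_bigr => y _ /=.
rewrite mulr_suml (reindex_inj (addrI y)); apply: eq_bigr => d _ /=.
have gamma_unit : (gamma y)^* * gamma y = 1.
  by rewrite mulrC -normCK gamma_norm expr1n.
rewrite gammaD !rmorphM /= conjCK.
by rewrite -[RHS]mul1r -gamma_unit; ring.
Qed.

Lemma normsq_fourier_uncorrelated mu gamma :
    in_dual gamma -> (forall d, d != 0 -> autocorrelation mu d = 0) ->
  `|fourier mu gamma| ^+ 2 = \sum_x `|mu x| ^+ 2.
Proof.
move=> gammaP mu_uncor; rewrite normsq_fourier // (bigD1 0) //= big1.
  rewrite addr0 in_dual0 // rmorph1 mul1r; apply: eq_bigr => x _.
  by rewrite addr0 -normCK.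
by move=> d /mu_uncor ->; rewrite mulr0.
Qed.

(** The mass is [#|E|] and the sum of squares is [#|E|] as well, so the quotient
    of norms and the modulus of the Fourier transform at every character are both
    [sqrt #|E|]; the trivial character therefore attains the maximum. *)
Lemma unimodular_uncorrelated_extreme mu E :
    E != set0 -> (forall x, `|mu x| = (x \in E)%:R) ->
    (forall d, d != 0 -> autocorrelation mu d = 0) ->
  extreme_measure mu /\ supp mu = E.
Proof.
move=> E_neq0 mu_norm mu_uncor.
have suppE : supp mu = E.
  by apply/setP=> x; rewrite inE -normr_eq0 mu_norm pnatr_eq0 eqb0 negbK.
have sum_indicator : \sum_x (x \in E)%:R = #|E|%:R :> C.
  by rewrite -natr_sum -sum1_card [in RHS]big_mkcond.
have massE : measure_norm mu = #|E|%:R.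
  by rewrite -sum_indicator; apply: eq_bigr => x _.
have sqrt_gt0 : 0 < sqrtC #|E|%:R :> C by rewrite sqrtC_gt0 ltr0n card_gt0.
have ratioE : measure_norm mu / sqrtC #|supp mu|%:R = sqrtC #|E|%:R.
  by rewrite suppE massE -{1}[#|E|%:R]sqrtCK expr2 mulfK // gt_eqF.
have fourierE gamma : in_dual gamma -> `|fourier mu gamma| = sqrtC #|E|%:R.
  move=> gammaP; apply/eqP; rewrite -(@eqrXn2 _ 2) // ?(ltW sqrt_gt0) //.
  rewrite sqrtCK normsq_fourier_uncorrelated // -sum_indicator.
  apply/eqP; apply: eq_bigr => x _; rewrite mu_norm.
  by case: (x \in E); rewrite ?expr1n ?expr0n.
split=> //; split.
  move=> mu0; case/set0Pn: E_neq0 => x xE; move: (mu_norm x).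
  by rewrite xE mu0 ffunE normr0 => /esym/eqP; rewrite oner_eq0.
rewrite ratioE; split; last by move=> gamma /fourierE ->.
by exists (fun=> 1); [exact: in_dual1 | rewrite fourierE //; exact: in_dual1].
Qed.

End Autocorrelation.

(** A first row of a circulant weighing matrix CW(13, 9), found by searching the
    [2 ^ 9] choices of signs on the given support. *)
Definition signs : seq int := [:: 1; 1; -1; 1; 1; 1; 0; -1; 0; -1; 1; 0; 0].

Lemma signs_uncorrelated (d : 'Z_13) :
  d != 0 -> \sum_(x : 'Z_13) signs`_(x + d)%R * signs`_x = 0.
Proof.
move=> d_neq0; rewrite !big_ord_recl big_ord0.
by case: d d_neq0; do 13?[case=> //]; move=> *; vm_compute.
Qed.

Lemma norm_signs (x : 'Z_13) :
  `|signs`_x| = (x \in [set 0; 1; 2%:R; 3%:R; 4%:R; 5%:R; 7%:R; 9%:R; 10%:R])%:R.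
Proof. by rewrite !inE; case: x; do 13?[case=> //]. Qed.

Theorem proposition7p24 (R : realType) :
  @extreme_set R[i] 'Z_13
    [set 0; 1; 2%:R; 3%:R; 4%:R; 5%:R; 7%:R; 9%:R; 10%:R].
Proof.
pose mu : {ffun 'Z_13 -> R[i]} := [ffun x : 'Z_13 => (signs`_x)%:~R].
set E := (X in extreme_set _ X).
suff [mu_extreme muE] : extreme_measure mu /\ supp mu = E by exists mu.
apply: unimodular_uncorrelated_extreme.
- by apply/set0Pn; exists 0; rewrite !inE eqxx.
- by move=> x; rewrite ffunE -intr_norm norm_signs; case: (x \in _).
move=> d /signs_uncorrelated/(congr1 (intr : int -> R[i])).
rewrite rmorph_sum => autocor0; rewrite -[RHS]autocor0.
by apply: eq_bigr => x _; rewrite !ffunE rmorph_int rmorphM.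
Qed.
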